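(* Let $\mathbb{V}$ be a vector space of dimension $n\ge 3$ over a field $\mathbb{F}$ with $q=2$ elements, and let $\Gamma(\mathbb{V})$ be its non-zero component graph with respect to a basis $\{b_1,\ldots,b_n\}$. Then the exchange property holds for identifying codes in $\Gamma(\mathbb{V})$.
   Context: Non-zero component graph: given a finite-dimensional vector space $\mathbb{V}$ over $\mathbb{F}$ with basis $\{b_1,\ldots,b_n\}$, $\Gamma(\mathbb{V})$ is the simple graph whose vertices are the non-zero vectors of $\mathbb{V}$; two distinct vertices are adjacent if and only if there is some $b_i$ that has non-zero coefficient in the unique linear combinations (with respect to the basis) of both. For a graph $\Gamma$ and a vertex $u$, $N(u)$ is the set of vertices adjacent to $u$ and $N[u]=N(u)\cup\{u\}$ is the closed neighborhood. A set $I_D\subseteq V(\Gamma)$ is an identifying code for $\Gamma$ if $N[u]\cap I_D\ne\emptyset$ for every $u\in V(\Gamma)$ and $N[u]\cap I_D\ne N[v]\cap I_D$ for all distinct $u,v\in V(\Gamma)$. An identifying code is minimal if it is minimal with respect to inclusion among identifying codes. Exchange property: identifying codes have the exchange property in $\Gamma$ if whenever $I_1$ and $I_2$ are minimal identifying codes for $\Gamma$ and $u_1\in I_1$, there exists $u_2\in I_2$ such that $(I_2\setminus\{u_2\})\cup\{u_1\}$ is also a minimal identifying code. *)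

(* Defs.v *)
From mathcomp Require Import all_boot all_order all_algebra.
From mathcomp Require Import boolp classical_sets.

Set Implicit Arguments.
Unset Strict Implicit.
Unset Printing Implicit Defensive.

Import GRing.Theory.
Local Open Scope ring_scope.
Local Open Scope classical_set_scope.

Record simple_graph (T : Type) := SimpleGraph {
  adj :> rel T;
  adj_sym : symmetric adj;
  adj_irr : irreflexive adj }.

Section IdentifyingCodes.
Variables (T : Type) (G : simple_graph T).

Definition nbhd (u : T) : set T := [set v | adj G u v].

Definition closed_nbhd (u : T) : set T := nbhd u `|` [set u].

Definition identifying_code (I : set T) : Prop :=
  (forall u : T, closed_nbhd u `&` I !=set0) /\
  (forall u v : T, u <> v -> closed_nbhd u `&` I <> closed_nbhd v `&` I).

Definition minimal_identifying_code (I : set T) : Prop :=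
  identifying_code I /\
  (forall J : set T, identifying_code J -> J `<=` I -> J = I).

Definition exchange_property : Prop :=
  forall (I1 I2 : set T) (u1 : T),
    minimal_identifying_code I1 -> minimal_identifying_code I2 -> I1 u1 ->
    exists2 u2 : T,
      I2 u2 & minimal_identifying_code ((I2 `\` [set u2]) `|` [set u1]).

End IdentifyingCodes.

Section NonZeroComponentGraph.
Variables (F : fieldType) (V : vectType F) (n : nat) (b : n.-tuple V).

Definition nonzero_vector : Type := {v : V | v != 0}.

(* [coord b i v] is the coefficient of the i-th vector of [b] in the expansion
   of [v] only when [b] is a basis, so [nzc_graph b] is the intended graph only
   under the hypothesis [basis_of {:V} b]. *)
Definition nzc_adj : rel nonzero_vector := fun u v =>
  (val u != val v) &&
  [exists i : 'I_n, (coord b i (val u) != 0) && (coord b i (val v) != 0)].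

Lemma nzc_adj_sym : symmetric nzc_adj.
Proof.
move=> u v; rewrite /nzc_adj eq_sym; congr (_ && _).
by apply: eq_existsb => i; rewrite andbC.
Qed.

Lemma nzc_adj_irr : irreflexive nzc_adj.
Proof. by move=> u; rewrite /nzc_adj eqxx. Qed.

Definition nzc_graph : simple_graph nonzero_vector :=
  SimpleGraph nzc_adj_sym nzc_adj_irr.

End NonZeroComponentGraph.

(* Main.v *)
Require Import Defs.
From mathcomp Require Import all_boot all_order all_algebra.
From mathcomp Require Import boolp classical_sets.

Set Implicit Arguments.
Unset Strict Implicit.
Unset Printing Implicit Defensive.

Import GRing.Theory.
Local Open Scope ring_scope.
Local Open Scope classical_set_scope.

(** Over the two-element field a vertex is its support, a nonempty subset of
    [{1, ..., n}], and [N[u]] consists of the vertices whose support meets that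
    of [u].  The basis vectors form an identifying code, since two distinct
    supports differ at some [i], and then [b_i] lies in exactly one of the two
    closed neighbourhoods.  Every identifying code contains every [b_i], because
    [b_i] is the only vertex that separates [b_1 + ... + b_n] from
    [b_1 + ... + b_n - b_i].  The basis is thus the only minimal identifying
    code, and exchange is trivial. *)

(** Minimality collapses every minimal code onto [S], so [I1] and [I2] coincide and [u2 := u1] is a
    valid exchange. *)
Lemma exchange_property_least (T : Type) (G : simple_graph T) (S : set T) :
  identifying_code G S -> (forall I, identifying_code G I -> S `<=` I) ->
  exchange_property G.
Proof.
move=> codeS leS.
have minE I : minimal_identifying_code G I -> I = S.
  by case=> codeI minI; rewrite (minI S codeS (leS I codeI)).
move=> I1 I2 u /minE -> /[dup] minI2 /minE eqI2.
by rewrite eqI2 in minI2 *; move=> Su; exists u => //; rewrite setUC setDUK // => x ->.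
Qed.

Lemma card2_neq0_eq1 (F : finFieldType) (x : F) : #|F| = 2 -> x != 0 -> x = 1.
Proof.
move=> hq x_neq0; apply/eqP/negPn/negP => x_neq1.
have uniq01x : uniq [:: 0; 1; x].
  by rewrite /= !inE !(eq_sym _ x) (negPf x_neq0) (negPf x_neq1) eq_sym oner_eq0.
by have := max_card (mem [:: 0; 1; x]); rewrite (card_uniqP uniq01x) hq.
Qed.

Section NonzeroComponentGraph.
Variables (F : fieldType) (V : vectType F) (n : nat) (b : n.-tuple V).
Hypothesis hb : basis_of {:V} b.

Lemma coord_basisE (i j : 'I_n) : coord b i b`_j = (i == j)%:R.
Proof. by rewrite (coord_free j i (basis_free hb)) eq_sym. Qed.

Lemma coord_basis_inj (u v : V) : (forall i, coord b i u = coord b i v) -> u = v.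
Proof.
move=> eq_uv; rewrite (coord_basis hb (memvf u)) (coord_basis hb (memvf v)).
by apply: eq_bigr => i _; rewrite eq_uv.
Qed.

Lemma coord_neq0 (u : V) : u != 0 -> exists i, coord b i u != 0.
Proof.
move=> u_neq0; apply/existsP; apply: contraNT u_neq0.
rewrite negb_exists => /forallP u0; apply/eqP/coord_basis_inj => i.
by rewrite linear0; apply/eqP/negPn.
Qed.

(** Passing to the closed neighbourhood absorbs the distinctness clause of adjacency: a nonzero
    vector shares a nonzero coordinate with itself. *)
Lemma closed_nbhd_nzcP (u v : nonzero_vector V) :
  closed_nbhd (nzc_graph b) u v <->
  exists i, (coord b i (val u) != 0) && (coord b i (val v) != 0).
Proof.
split=> [[/andP[_ /existsP//]|->]|].
  by have [i ui] := coord_neq0 (valP u); exists i; rewrite ui.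
move=> exi; have [eq_uv|neq_uv] := eqVneq (val u) (val v).
  by right; apply/esym/val_inj.
by left; rewrite /nbhd /= /nzc_adj neq_uv; apply/existsP.
Qed.

Lemma basis_neq0 (i : 'I_n) : b`_i != 0.
Proof.
apply/eqP => bi0; have /eqP := coord_basisE i i.
by rewrite bi0 linear0 eqxx eq_sym oner_eq0.
Qed.

Definition basis_vertex (i : 'I_n) : nonzero_vector V :=
  exist _ b`_i (basis_neq0 i).

Lemma closed_nbhd_basis_vertex (u : nonzero_vector V) (i : 'I_n) :
  closed_nbhd (nzc_graph b) u (basis_vertex i) <-> coord b i (val u) != 0.
Proof.
split=> [/closed_nbhd_nzcP[j]|ui].
  by rewrite coord_basisE; have [->/andP[]|_] := eqVneq j i; rewrite ?eqxx ?andbF.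
by apply/closed_nbhd_nzcP; exists i; rewrite ui coord_basisE eqxx oner_neq0.
Qed.

Lemma coord_sum_basis (i : 'I_n) : coord b i (\sum_(j < n) b`_j) = 1.
Proof.
rewrite linear_sum (bigD1 i) //= coord_basisE eqxx big1 ?addr0 // => j jNi.
by rewrite coord_basisE eq_sym (negPf jNi).
Qed.

(** Over a general field the separating vertex [w] is only a nonzero multiple of [b_i], hence the
    formulation by supports. *)
Lemma identifying_code_support1 (I : set (nonzero_vector V)) (i : 'I_n) :
  (1 < n)%N -> identifying_code (nzc_graph b) I ->
  exists2 w, I w & forall j, (coord b j (val w) != 0) = (j == i).
Proof.
move=> n_gt1 [_ sepI]; pose x := \sum_(j < n) b`_j; pose y := x - b`_i.
have yE j : coord b j y = (j != i)%:R.
  by rewrite linearB /= coord_sum_basis coord_basisE; case: eqP; rewrite ?subrr ?subr0.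
have x_neq0 : x != 0.
  apply: contraTneq (oner_neq0 F) => x0.
  by rewrite negbK -(coord_sum_basis i) -/x x0 linear0.
have y_neq0 : y != 0.
  have [j jNi] : exists j, j != i.
    have /card_gt0P[j jNi] : (0 < #|predC1 i|)%N by rewrite cardC1 card_ord -subn1 subn_gt0.
    by exists j.
  apply: contraTneq (oner_neq0 F) => y0.
  (* Here [1] is recast as the [j]-th coordinate of [y], for an index [j] other than [i]. *)
  by rewrite negbK -[1]/(true%:R) -jNi -yE y0 linear0.
pose u : nonzero_vector V := exist _ x x_neq0.
pose v : nonzero_vector V := exist _ y y_neq0.
have neq_uv : u <> v.
  move=> /(congr1 val)/= xy; have := coord_sum_basis i.
  by rewrite -/x xy yE eqxx => /esym/eqP; rewrite oner_eq0.
have subuv : closed_nbhd (nzc_graph b) v `<=` closed_nbhd (nzc_graph b) u.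
  move=> w /closed_nbhd_nzcP[j /andP[_ wj]]; apply/closed_nbhd_nzcP; exists j.
  by rewrite coord_sum_basis oner_neq0.
(* As N[v] lies in N[u], the traces on [I] can differ only by a point of N[u] outside N[v]. *)
have [w [Nuw Iw] Nvw] : exists2 w, (closed_nbhd (nzc_graph b) u `&` I) w
    & ~ closed_nbhd (nzc_graph b) v w.
  apply: contrapT => noW; apply: (sepI u v neq_uv); apply/seteqP; split=> w [Nw Iw].
    by split=> //; apply: contrapT => Nvw; apply: noW; exists w.
  by split=> //; apply: subuv.
(* The support of [v] is everything except [i], and [w] avoids it. *)
have w0 j : j != i -> coord b j (val w) = 0.
  move=> jNi; apply/eqP/negPn/negP => wj; apply: Nvw; apply/closed_nbhd_nzcP.
  by exists j; rewrite yE jNi oner_neq0.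
exists w => // j; have [->|/w0->] := eqVneq j i; last by rewrite eqxx.
have [k wk] := coord_neq0 (valP w).
by have [<-//|/w0 wk0] := eqVneq k i; rewrite wk0 eqxx in wk.
Qed.

End NonzeroComponentGraph.

Local Close Scope classical_set_scope.
Local Close Scope ring_scope.

Theorem mainTheorem5 (F : finFieldType) (hq : #|F| = 2)
  (V : vectType F) (n : nat) (hn : 3 <= n)
  (b : n.-tuple V) (hb : basis_of {:V} b) :
  exchange_property (nzc_graph b).
Proof.
(* This is where two elements matter: a vector is determined by its support. *)
have eqF (x y : F) : (x != 0%R) = (y != 0%R) -> x = y.
  have [->|/(card2_neq0_eq1 hq)->] := eqVneq x 0%R;
  have [->|/(card2_neq0_eq1 hq)->] := eqVneq y 0%R; by rewrite ?eqxx ?oner_eq0.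
apply: (@exchange_property_least _ _ (range (basis_vertex hb))); first split.
- move=> u; have [i ui] := coord_neq0 hb (valP u).
  by exists (basis_vertex hb i); split; [apply/closed_nbhd_basis_vertex | exists i].
(* The trace of N[u] on the basis records exactly the support of [u]. *)
- move=> u v neq_uv Nuv; apply/neq_uv/val_inj/(coord_basis_inj hb) => i.
  apply: eqF; apply/idP/idP => /(closed_nbhd_basis_vertex hb) Ni;
    apply/(closed_nbhd_basis_vertex hb).
  + have : (closed_nbhd (nzc_graph b) u `&` range (basis_vertex hb))%classic (basis_vertex hb i).
      by split=> //; exists i.
    by rewrite Nuv => -[].
  + have : (closed_nbhd (nzc_graph b) v `&` range (basis_vertex hb))%classic (basis_vertex hb i).
      by split=> //; exists i.
    by rewrite -Nuv => -[].
- move=> I codeI _ [i _ <-].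
  have [w Iw wE] := identifying_code_support1 hb i (ltnW hn) codeI.
  suff -> : basis_vertex hb i = w by [].
  apply/val_inj/(coord_basis_inj hb) => j; apply: eqF.
  by rewrite wE /= coord_basisE //; case: (j == i); rewrite ?oner_neq0 ?eqxx.
Qed.
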